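(* Let $X$ be a real-valued random variable on a probability space $(\Omega,\mathscr F,\mathsf P)$ with distribution function $F_X$, and let $\mathsf J_X(x)=\int_0^x F_X(t)\,dt$, $x\in\mathbb R$, be its integrated distribution function. Then: (i) $\mathsf J_X(0)=0$. (ii) $\mathsf J_X$ is convex, increasing and finite everywhere on $\mathbb R$. (iii) For $a<b$, $\mathsf J_X(b)-\mathsf J_X(a)=\mathsf E[(b-X)^+-(X-a)^-]$; in particular, for $x\in\mathbb R$, $\mathsf J_X(x)=\mathsf E[(x-X)^+-X^-]=\mathsf E[(X-x)^+-X^++x]$. (iv) $\lim_{x\to-\infty}\mathsf J_X(x)=-\mathsf E[X^-]$ and $\lim_{x\to+\infty}(x-\mathsf J_X(x))=\mathsf E[X^+]$. (v) $\lim_{x\to-\infty}\mathsf J_X(x)/x=0$ and $\lim_{x\to+\infty}\mathsf J_X(x)/x=1$. (vi) The subdifferential of $\mathsf J_X$ satisfies $\partial\mathsf J_X(x)=[F_X(x-0),F_X(x)]$ for all $x\in\mathbb R$; in particular $(\mathsf J_X)'_-(x)=F_X(x-0)$ and $(\mathsf J_X)'_+(x)=F_X(x)$. (vii) $\mathsf J_{-X}(x)=x+\mathsf J_X(-x)$ for all $x\in\mathbb R$.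
   Context: $F_X(x)=\mathsf P(X\le x)$, and $F_X(x-0)$ is its left limit at $x$. For $b<a$, $\int_a^b f:=-\int_b^a f$. $y^+=\max(y,0)$, $y^-=\max(-y,0)$. ''Increasing'' means nondecreasing. No integrability of $X$ is assumed; $\mathsf E[X^\pm]$ may be $+\infty$, and the limits in (iv) are understood in the extended reals. The subdifferential of a convex function $f:\mathbb R\to\mathbb R\cup\{+\infty\}$ at $x$ is $\partial f(x)=\{u\in\mathbb R: f(y)\ge f(x)+u(y-x)\ \forall y\in\mathbb R\}$; $f'_-$ and $f'_+$ are the left and right derivatives. *)

(* Defs.v *)
From HB Require Import structures.
From mathcomp Require Export all_boot all_order all_algebra.
From mathcomp Require Export all_classical all_reals all_analysis.
From mathcomp Require Export measurable_realfun.

Set Implicit Arguments.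
Unset Strict Implicit.
Unset Printing Implicit Defensive.

Import Order.TTheory GRing.Theory Num.Theory.
Import numFieldNormedType.Exports.

Local Open Scope classical_set_scope.
Local Open Scope ring_scope.

(* Extended-real valued, so that finiteness of the integral is a meaningful
   assertion. *)
Definition oriented_integral (R : realType) (f : R -> R) (a b : R) : \bar R :=
  if a <= b then (\int[lebesgue_measure]_(t in `[a, b]) (f t)%:E)%E
  else (- \int[lebesgue_measure]_(t in `[b, a]) (f t)%:E)%E.

Section distribution_function.
Context (d : measure_display) (T : measurableType d) (R : realType).
Context (P : probability T R).

Definition distribution_function (X : {RV P >-> R}) (x : R) : R :=
  fine (cdf X x).

Lemma distribution_functionE (X : {RV P >-> R}) x :
  (distribution_function X x)%:E = P (X @^-1` [set r | r <= x]).
Proof.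
by rewrite /distribution_function fineK ?fin_num_measure.
Qed.

Definition distribution_function_left (X : {RV P >-> R}) (x : R) : R :=
  lim (distribution_function X t @[t --> x^'-]).

Lemma distribution_function_nd (X : {RV P >-> R}) :
  nondecreasing_fun (distribution_function X).
Proof.
by move=> x y xy; rewrite fine_le ?fin_num_measure// cdf_nondecreasing.
Qed.

Lemma distribution_function_leftP (X : {RV P >-> R}) x :
  distribution_function X t @[t --> x^'-] --> distribution_function_left X x.
Proof.
apply: nondecreasing_at_left_is_cvgr.
- by near=> y => r s _ _; exact: distribution_function_nd.
- near=> y; exists 1 => _ [z _ <-].
  by rewrite -lee_fin fineK ?fin_num_measure// cdf_le1.
Unshelve. all: by end_near. Qed.

Definition integrated_distribution_function (X : {RV P >-> R}) (x : R) :
  \bar R := oriented_integral (distribution_function X) 0 x.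

End distribution_function.

Definition subdifferential (R : realType) (f : R -> \bar R) (x : R) : set R :=
  [set u : R | forall y : R, (f x + (u * (y - x))%:E <= f y)%E].

Definition is_left_derivative (R : realType) (f : R -> R) (x l : R) : Prop :=
  (f (x + h) - f x) / h @[h --> 0^'-] --> l.

Definition is_right_derivative (R : realType) (f : R -> R) (x l : R) : Prop :=
  (f (x + h) - f x) / h @[h --> 0^'+] --> l.

(* Main.v *)
(* By Tonelli, J b - J a is the expectation of (b - X)^+ - (X - a)^-, a bounded
   random variable, so J x = E[(x - X)^+ - X^-]. Integrating the pointwise
   inequality 1_{X <= x} (y - x) <= (y - X)^+ - (x - X)^+ shows that F x is a
   subgradient of J at x for every x; convexity, monotonicity, the one-sided
   derivatives, the subdifferential and the slopes at infinity all follow from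
   this and the limits of F. The limit of J at -oo is monotone convergence, and
   the one at +oo follows from it by the reflection X -> -X. *)
Require Import Defs.
From mathcomp Require Import all_boot all_order all_algebra.
From mathcomp Require Import all_classical all_reals all_analysis.
From mathcomp Require Import measurable_realfun.
From mathcomp Require Import ring lra.

Set Implicit Arguments.
Unset Strict Implicit.
Unset Printing Implicit Defensive.

Import Order.TTheory GRing.Theory Num.Theory.
Import numFieldNormedType.Exports.

Local Open Scope classical_set_scope.
Local Open Scope ring_scope.

(** * Real functions [f] with a selection [g] of subgradients *)

Section subgradient.
Context (R : realType) (f g : R -> R).
Hypothesis subgrad : forall x y, g x * (y - x) <= f y - f x.

(** The supporting line at the intermediate point [z] lies below [f] at [x] and at [y]; in the
    weighted sum of the two inequalities the slope terms cancel. *)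
Lemma subgradient_convex : convex_function [set: R^o] f.
Proof.
have key (s x y : R) : 0 <= s -> 0 <= 1 - s ->
    f (s * x + (1 - s) * y) <= s * f x + (1 - s) * f y.
  move=> s0 s1; set z := s * x + _.
  have := lerD (ler_wpM2l s0 (subgrad z x)) (ler_wpM2l s1 (subgrad z y)).
  have -> : s * (g z * (x - z)) + (1 - s) * (g z * (y - z)) = 0.
    by rewrite /z; ring.
  lra.
by move=> t x y _ _; apply: key; rewrite ?subr_ge0.
Qed.

(** For [h > 0] the subgradients at [x] and at [x + h] squeeze the difference quotient between [g x]
    and [g (x + h)]. *)
Lemma subgradient_right_derivative x :
  g t @[t --> x^'+] --> g x -> is_right_derivative f x (g x).
Proof.
move=> gx; apply: (@squeeze_cvgr _ _ _ _ (fun=> g x) (fun h => g (x + h))).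
- near=> h; have h0 : 0 < h by near: h; exact: nbhs_right_gt.
  rewrite ler_pdivlMr// ler_pdivrMr//; apply/andP; split.
    by have := subgrad x (x + h); rewrite addrAC subrr add0r.
  by have := subgrad (x + h) x; lra.
- exact: cvg_cst.
- apply/cvgrPdist_lt => e e0.
  move/cvgrPdist_lt : gx => /(_ _ e0) [r /= r0 H].
  exists r => //= h /=; rewrite sub0r normrN => hr h0; apply: H => /=.
    by rewrite opprD addNKr normrN.
  by rewrite ltrDl.
Unshelve. all: by end_near. Qed.

(* Combine the subgradient inequalities from t to y and from x to t, then let
   t tend to x from the left; no continuity of f is needed. *)
Lemma left_limit_subgradient x (l : R) :
  g t @[t --> x^'-] --> l -> forall y, l * (y - x) <= f y - f x.
Proof.
move=> gl y.
apply: (@cvgr_to_le _ (x^'-) _ _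
  (fun t => g t * (y - t) - g x * (x - t)) (l * (y - x))); last first.
  by near=> t; have := subgrad t y; have := subgrad x t; lra.
rewrite (_ : l * (y - x) = l * (y - x) - g x * (x - x)); last by ring.
have idx : t @[t --> x^'-] --> x by apply: cvg_at_left_filter; exact: cvg_id.
apply: cvgB.
  by apply: cvgM => //; apply: cvgB => //; exact: cvg_cst.
by apply: cvgM; [exact: cvg_cst | apply: cvgB => //; exact: cvg_cst].
Unshelve. all: by end_near. Qed.

Lemma subgradient_left_derivative x (l : R) :
  g t @[t --> x^'-] --> l -> is_left_derivative f x l.
Proof.
move=> gl; apply: (@squeeze_cvgr _ _ _ _ (fun h => g (x + h)) (fun=> l)).
(* Dividing by [h < 0] reverses the inequalities, so [g (x + h)] is now the lower bound; [l], itself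
   a subgradient at [x], is the upper one. *)
- near=> h; have h0 : h < 0 by near: h; exact: nbhs_left_lt.
  rewrite ler_ndivlMr// ler_ndivrMr//; apply/andP; split.
    by have := subgrad (x + h) x; lra.
  by have := left_limit_subgradient gl (x + h); rewrite addrAC subrr add0r.
- apply/cvgrPdist_lt => e e0.
  move/cvgrPdist_lt : gl => /(_ _ e0) [r /= r0 H].
  exists r => //= h /=; rewrite sub0r normrN => hr h0; apply: H => /=.
    by rewrite opprD addNKr normrN.
  by rewrite gtrDl.
- exact: cvg_cst.
Unshelve. all: by end_near. Qed.

Lemma subgradientP x (l : R) :
  g t @[t --> x^'-] --> l -> g t @[t --> x^'+] --> g x ->
  forall u, (forall y, f x + u * (y - x) <= f y) <-> l <= u <= g x.
Proof.
move=> gl gr u; split=> [H|/andP[lu ug] y].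
  apply/andP; split.
    (* Monotonicity of subgradients: adding the inequalities for [g t] at [t] and [u] at [x] gives
       [g t <= u] when [t < x]; symmetrically on the right. *)
    apply: (cvgr_to_le gl); near=> t.
    have tx : t < x by near: t; exact: nbhs_left_lt.
    rewrite -(@ler_pM2r _ (x - t)) ?subr_gt0//.
    by have := subgrad t x; have := H t; lra.
  apply: (cvgr_to_ge gr); near=> t.
  have xt : x < t by near: t; exact: nbhs_right_gt.
  rewrite -(@ler_pM2r _ (t - x)) ?subr_gt0//.
  by have := subgrad t x; have := H t; lra.
rewrite addrC -lerBrDr; have [xy|yx] := leP x y.
  by apply: le_trans (subgrad x y); rewrite ler_wpM2r// subr_ge0.
apply: le_trans (left_limit_subgradient gl y).
by rewrite ler_wnM2r// subr_le0 ltW.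
Unshelve. all: by end_near. Qed.

Lemma subgradient_cvg_slope_pinfty (l : R) : f 0 = 0 ->
  g x @[x --> +oo] --> l -> f x / x @[x --> +oo] --> l.
Proof.
move=> f0 gl; apply/cvgrPdist_le => e e0.
have e20 : 0 < e / 2 by rewrite divr_gt0.
move/cvgrPdist_le : (gl) => /(_ _ e20) gle2.
have [a] := filter_ex gle2; rewrite ler_distlC => /andP[gae _].
(* The supporting line at [a] is [g a * x + c], with slope at least [l - e / 2]; its intercept costs
   at most another [e / 2] once divided by a large [x]. *)
set c := f a - g a * a.
near=> x.
have x0 : 0 < x by near: x; exact: nbhs_pinfty_gt.
have cx : `|c| <= e / 2 * x.
  by rewrite mulrC -ler_pdivrMr//; near: x; apply: nbhs_pinfty_ge; rewrite num_real.
have : `|l - g x| <= e / 2 by near: x.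
rewrite !ler_distlC => /andP[_ gx].
apply/andP; split.
  rewrite ler_pdivlMr//.
  have := subgrad a x; move: cx; rewrite ler_norml => /andP[cx _].
  have := ler_wpM2r (ltW x0) gae; rewrite /c in cx; lra.
rewrite ler_pdivrMr//.
(* The subgradient at [x], tested at the origin, gives the upper bound [f x <= g x * x]. *)
have := subgrad x 0; rewrite f0.
have := ler_wpM2r (ltW x0) gx; have := mulr_gt0 e0 x0; lra.
Unshelve. all: by end_near. Qed.

End subgradient.

Lemma subgradient_cvg_slope_ninfty (R : realType) (f g : R -> R) (l : R) :
  (forall x y, g x * (y - x) <= f y - f x) -> f 0 = 0 ->
  g x @[x --> -oo] --> l -> f x / x @[x --> -oo] --> l.
Proof.
move=> subgrad f0 /cvgNy_compNP gl; apply/cvgNy_compNP.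
(* Reflection: [- g (- x)] is a subgradient of the function [f (- x)], which reduces the claim to
   the slope at [+oo]. *)
have sN x y : (- g (- x)) * (y - x) <= f (- y) - f (- x).
  by apply: le_trans (subgrad _ _); rewrite mulNr -mulrN; lra.
rewrite -[l]opprK.
rewrite [X in X @ _ --> _](_ : _ = (fun x => - (f (- x) / x))); last first.
  by apply/funext => x /=; rewrite invrN mulrN.
apply: cvgN; apply: (subgradient_cvg_slope_pinfty sN); first by rewrite oppr0.
exact: cvgN.
Qed.

(** * Expectation formulas for the integrated distribution function *)

Section integrated_cdf.
Context (d : measure_display) (T : measurableType d) (R : realType).
Context (P : probability T R) (X : {RV P >-> R}).

Local Notation mu := (@lebesgue_measure R).
Local Notation F := (distribution_function X).
Local Notation J := (integrated_distribution_function X).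

Lemma integral_distribution_function (a b : R) : a <= b ->
  (\int[mu]_(t in `[a, b]) (F t)%:E)%E =
  'E_P[((cst b \- X)^\+ \- (X \- cst a)^\-)%R]%E.
Proof.
move=> ab.
(* Tonelli is applied to the indicator of [A]: its section at [t] in [[a, b]] has probability [F t],
   and its section at [w] is an interval whose length is the integrand on the right. *)
pose A : set (measurableTypeR R * T) :=
  [set p | p.1 \in `[a, b] /\ X p.2 <= p.1].
have mA : measurable A.
  rewrite (_ : A = (`[a, b] `*` setT) `&`
     ((fun p : measurableTypeR R * T => X p.2 - p.1) @^-1` `]-oo, 0])); last first.
    apply/seteqP; split=> -[t w]/=; rewrite in_itv/= /A/= in_itv/= in_itv/= subr_le0.
    - by move=> [].
    - by move=> [[h1 _] h2].
  apply: measurableI; first exact: measurableX.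
  rewrite -[X in measurable X]setTI.
  have : measurable_fun setT (fun p : measurableTypeR R * T => X p.2 - p.1).
    apply: measurable_funB; first exact: measurableT_comp.
    exact: measurable_fst.
  by apply.
have := @indic_fubini_tonelli _ _ _ _ _
  (mu : {sigma_finite_measure set (measurableTypeR R) -> \bar R}) P A mA.
rewrite indic_fubini_tonelli_FE// indic_fubini_tonelli_GE// => FT.
rewrite integral_mkcond.
transitivity (\int[mu]_t (P \o xsection A) t)%E.
  apply: eq_integral => t _ /=.
  rewrite patchE; case: ifPn; rewrite ?inE ?notin_setE/= => tab.
    rewrite distribution_functionE; congr (P _).
    apply/seteqP; split=> w/=; rewrite /xsection/= inE /A/=; first by [].
    by case.
  rewrite (_ : xsection A t = set0) ?measure0//.
  by apply/seteqP; split=> w//=; rewrite /xsection/= inE /A/= => -[].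
rewrite FT unlock; apply: eq_integral => w _ /=.
rewrite (_ : ysection A w = `[Num.max a (X w), b]%classic); last first.
  apply/seteqP; split=> t/=; rewrite /ysection/= inE /A/= !in_itv/= ge_max.
    by move=> [/andP[-> ->] ->].
  by move=> /andP[/andP[-> ->] ->].
rewrite [LHS]lebesgue_measure_itv/= lte_fin /funrpos /funrneg/=.
rewrite -!EFinB; case: ifPn => h; [congr EFin|congr EFin].
all: by move: h ab; rewrite /Num.max; repeat case: ifPn; lra.
Qed.

Lemma bounded_Lfun1 (Y : T -> R) (M : R) :
  measurable_fun setT Y -> (forall w, `|Y w| <= M) -> Y \in Lfun P 1.
Proof.
move=> mY YM; apply/Lfun1_integrable; apply: measurable_bounded_integrable => //.
  by rewrite -ge0_fin_numE// fin_num_measure.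
by exists M; split; rewrite ?num_real// => y My w _; exact: le_trans (YM w) (ltW My).
Qed.

Local Notation excess x := (((cst x \- X)^\+ \- X^\-)%R : T -> R).

Lemma measurable_excess (x : R) : measurable_fun setT (excess x).
Proof.
by apply: measurable_funB; [apply: measurable_funrpos; exact: measurable_funB|
  exact: measurable_funrneg].
Qed.

(** The positive part is 1-Lipschitz, so the difference is bounded by [|x|] even when [X] is not
    integrable. *)
Lemma excess_Lfun (x : R) : excess x \in Lfun P 1.
Proof.
apply: (bounded_Lfun1 (M := `|x|)) => [|w].
  exact: measurable_excess.
rewrite /funrpos /funrneg/= /Num.max ler_norml.
by have := ler_norm x; have := ler_norm (- x); rewrite normrN; repeat case: ifPn; lra.
Qed.

Lemma integrated_distribution_functionE (x : R) : J x = 'E_P[excess x]%E.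
Proof.
rewrite /integrated_distribution_function /oriented_integral.
case: ifPn => [x0|]; last rewrite -ltNge => /ltW x0.
  rewrite integral_distribution_function//; congr expectation.
  by apply/funext => w /=; rewrite /funrneg/= subr0.
rewrite integral_distribution_function//.
(* For [x < 0] the integral runs over [[x, 0]], and its integrand is the opposite of [excess x]. *)
rewrite [X in (- 'E_P[X])%E](_ : _ = (fun w => -1 * excess x w)); last first.
  apply/funext => w /=; rewrite /funrpos /funrneg/=.
  by rewrite /Num.max; repeat case: ifPn; lra.
rewrite [X in (- 'E_P[X])%E](_ : _ = -1 \o* excess x); last first.
  by apply/funext => w /=; rewrite mulrC.
by rewrite expectationZl ?excess_Lfun// EFinN mulN1e oppeK.
Qed.

Lemma integrated_distribution_function_fin_num (x : R) : J x \is a fin_num.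
Proof.
by rewrite integrated_distribution_functionE expectation_fin_num// excess_Lfun.
Qed.

Lemma integrated_distribution_function_diff (a b : R) :
  (J b - J a)%E = 'E_P[((cst b \- X)^\+ \- (X \- cst a)^\-)%R]%E.
Proof.
rewrite !integrated_distribution_functionE -expectationB ?excess_Lfun//.
congr expectation; apply/funext => w /=; rewrite /funrpos /funrneg/=.
by rewrite (opprB (X w) a); lra.
Qed.

Lemma integrated_distribution_function_shift (x : R) :
  J x = 'E_P[(((X \- cst x)^\+ \- X^\+) \+ cst x)%R]%E.
Proof.
rewrite integrated_distribution_functionE; congr expectation.
apply/funext => w /=; rewrite /funrpos /funrneg/=.
by rewrite /Num.max; repeat case: ifPn; lra.
Qed.

(** * Subgradient inequality and its consequences for [J] *)

Lemma integrated_distribution_function_subgradient (x y : R) :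
  F x * (y - x) <= fine (J y) - fine (J x).
Proof.
rewrite -lee_fin EFinM [leRHS]EFinB distribution_functionE.
rewrite !fineK ?integrated_distribution_function_fin_num//.
rewrite integrated_distribution_function_diff.
have mA : measurable (X @^-1` [set r | r <= x]).
  rewrite -set_itvNyc -[X in measurable X]setTI.
  exact: measurable_funP.
have L1 : (\1_(X @^-1` [set r | r <= x]) : T -> R) \in Lfun P 1.
  apply: (bounded_Lfun1 (M := 1)) => [|w].
    exact: measurable_indic.
  by rewrite indicE; case: (_ \in _); rewrite ?normr1 ?normr0.
have L2 : ((y - x) \o* \1_(X @^-1` [set r | r <= x]) : T -> R) \in Lfun P 1.
  apply: (bounded_Lfun1 (M := `|y - x|)) => [|w /=].
    by apply: measurable_funM => //; exact: measurable_indic.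
  by rewrite indicE; case: (_ \in _); rewrite ?mul1r ?mul0r ?normr0.
have L3 : (((cst y \- X)^\+ \- (X \- cst x)^\-)%R : T -> R) \in Lfun P 1.
  apply: (bounded_Lfun1 (M := `|y - x|)) => [|w].
    apply: measurable_funB.
      by apply: measurable_funrpos; exact: measurable_funB.
    by apply: measurable_funrneg; exact: measurable_funB.
  rewrite /funrpos /funrneg/= /Num.max ler_norml (opprB (X w) x).
  by have := ler_norm (y - x); have := ler_norm (- (y - x)); rewrite normrN;
     repeat case: ifPn; lra.
rewrite -expectation_indic// muleC -expectationZl// unlock.
apply: le_integral => //; [exact/Lfun1_integrable|exact/Lfun1_integrable|].
(* If [X w <= x], then [(y - X w)^+ - (x - X w) >= y - x]; otherwise the subtracted part vanishes
   and the rest is nonnegative. *)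
move=> w _; rewrite lee_fin /= indicE /funrpos /funrneg/= (opprB (X w) x).
have -> : (w \in X @^-1` [set r | r <= x]) = (X w <= x).
  by apply/idP/idP; rewrite inE.
by rewrite /Num.max; case: (leP (X w) x) => h; rewrite ?mul1r ?mul0r;
   repeat case: ifPn; lra.
Qed.

Lemma integrated_distribution_function_nd : nondecreasing_fun J.
Proof.
move=> x y xy; have Jfin := integrated_distribution_function_fin_num.
rewrite -(fineK (Jfin x)) -(fineK (Jfin y)) lee_fin -subr_ge0.
apply: le_trans (integrated_distribution_function_subgradient x y).
by rewrite mulr_ge0 ?subr_ge0// fine_ge0.
Qed.

Lemma distribution_function_right_continuous (x : R) :
  F t @[t --> x^'+] --> F x.
Proof.
apply: fine_cvg; rewrite fineK ?fin_num_measure//.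
exact: cdf_right_continuous.
Qed.

(** * Limit at [-oo] and reflection *)

Lemma cvg_integrated_distribution_functionNy :
  J x @[x --> -oo] --> (- 'E_P[(X^\-)%R])%E.
Proof.
(* [g n] is the truncation of [X^\-] at level [n]: nonnegative, nondecreasing in [n], and equal to
   [X^\-] at [w] once [n >= - X w]. *)
pose g (n : nat) w := (- excess (- n%:R) w)%:E.
have mg n : measurable_fun setT (g n).
  apply/measurable_EFinP; apply: (measurableT_comp (@oppr_measurable R setT)).
  exact: measurable_excess.
have g0 n w : setT w -> (0 <= g n w)%E.
  move=> _; rewrite /g lee_fin /funrpos /funrneg/=.
  have : 0 <= n%:R :> R by [].
  by rewrite /Num.max; repeat case: ifPn; lra.
have ndg w : setT w -> {homo g^~ w : n m / (n <= m)%N >-> (n <= m)%E}.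
  move=> _ n m; rewrite -(ler_nat R) => nm; rewrite /g lee_fin /funrpos /funrneg/=.
  have : 0 <= n%:R :> R by [].
  by rewrite /Num.max; repeat case: ifPn; lra.
have := cvg_monotone_convergence (mu := P) measurableT mg g0 ndg.
rewrite (_ : (\int[P]_w limn (g^~ w))%E = 'E_P[(X^\-)%R]%E); last first.
  rewrite unlock; apply: eq_integral => w _.
  apply/cvg_lim => //; apply: cvg_near_cst; near=> n.
  rewrite /g; congr EFin; rewrite /funrpos /funrneg/=.
  have : - X w <= n%:R by near: n; exact: nbhs_infty_ger.
  by rewrite /Num.max; repeat case: ifPn; lra.
rewrite (_ : (fun n => _) = (fun n => - J (- n%:R))%E); last first.
  apply/funext => n; rewrite integrated_distribution_functionE.
  rewrite -[RHS]mulN1e -EFinN -expectationZl ?excess_Lfun// unlock.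
  by apply: eq_integral => w _; rewrite /g/= mulrN1.
move=> /cvgeN; under eq_fun do rewrite oppeK; move=> Jn.
apply/cvgNy_compNP.
(* From integers to reals: monotonicity provides a limit, the infimum, which the subsequence along
   [n] identifies. *)
have Jninc : nonincreasing_fun (J \o -%R).
  by move=> x y xy /=; apply: integrated_distribution_function_nd; rewrite lerN2.
have Jinf := nonincreasing_cvge Jninc.
suff <- : ereal_inf (range (J \o -%R)) = (- 'E_P[(X^\-)%R])%E by [].
move/cvge_pinftyP : Jinf => /(_ (fun n => n%:R) (@cvgr_idn R)) Jinf.
exact: cvg_unique Jinf Jn.
Unshelve. all: by end_near. Qed.

End integrated_cdf.

Lemma integrated_distribution_functionN (d : measure_display)
    (T : measurableType d) (R : realType) (P : probability T R)
    (X : {RV P >-> R}) (x : R) :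
  integrated_distribution_function (- X : {RV P >-> R}) x =
  (x%:E + integrated_distribution_function X (- x)%R)%E.
Proof.
rewrite !integrated_distribution_functionE -[x%:E in RHS](expectation_cst P).
rewrite -expectationD ?excess_Lfun//; last first.
  by apply: (@bounded_Lfun1 _ _ _ P _ `|x|).
(* Pointwise this is [y^+ = y + (- y)^+], used at [y = x + X w] and at [y = X w]. *)
congr expectation; apply/funext => w /=; rewrite /funrpos /funrneg/=.
change (Num.max (x - - X w) 0 - Num.max (- - X w) 0 =
  x + (Num.max (- x - X w) 0 - Num.max (- X w) 0)).
by rewrite /Num.max; repeat case: ifPn; lra.
Qed.

Theorem theorem1 (d : measure_display) (T : measurableType d) (R : realType)
    (P : probability T R) (X : {RV P >-> R}) :
  let F := distribution_function X in
  let Fleft := distribution_function_left X in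
  let J := integrated_distribution_function X in
  (* (i) *)
  J 0 = 0%E /\
  (* (ii) *)
  [/\ convex_function [set: R^o] (fine \o J),
      nondecreasing_fun J
    & forall x : R, J x \is a fin_num] /\
  (* (iii) *)
  [/\ forall a b : R, a < b ->
        (J b - J a)%E = 'E_P[((cst b \- X)^\+ \- (X \- cst a)^\-)%R]%E,
      forall x : R, J x = 'E_P[((cst x \- X)^\+ \- X^\-)%R]%E
    & forall x : R, J x = 'E_P[(((X \- cst x)^\+ \- X^\+) \+ cst x)%R]%E] /\
  (* (iv) *)
  (J x @[x --> -oo] --> (- 'E_P[(X^\-)%R])%E /\
   (x%:E - J x)%E @[x --> +oo] --> 'E_P[(X^\+)%R]%E) /\
  (* (v) *)
  (fine (J x) / x @[x --> -oo] --> (0 : R) /\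
   fine (J x) / x @[x --> +oo] --> (1 : R)) /\
  (* (vi) *)
  (forall x : R,
    [/\ subdifferential J x = `[Fleft x, F x]%classic,
        is_left_derivative (fine \o J) x (Fleft x)
      & is_right_derivative (fine \o J) x (F x)]) /\
  (* (vii) *)
  (forall x : R,
     integrated_distribution_function (- X : {RV P >-> R}) x =
       (x%:E + J (- x)%R)%E).
Proof.
move=> F Fleft J.
have Jfin x : J x \is a fin_num by exact: integrated_distribution_function_fin_num.
have SG := integrated_distribution_function_subgradient X.
have J0 : J 0 = 0%E.
  rewrite /J integrated_distribution_functionE -[RHS](expectation_cst P).
  congr expectation; apply/funext => w /=; rewrite /funrpos /funrneg/=.
  by rewrite sub0r subrr.
have fJ0 : fine (J 0) = 0 by rewrite J0.
split=> //; split.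
  split=> //; first exact: (subgradient_convex SG).
  exact: integrated_distribution_function_nd.
split.
  split=> [a b _|x|x].
  - exact: integrated_distribution_function_diff.
  - exact: integrated_distribution_functionE.
  - exact: integrated_distribution_function_shift.
split.
  split; first exact: cvg_integrated_distribution_functionNy.
  (* The limit at [-oo] for [- X], read at [- x] and negated, is the one at [+oo]: reflection turns
     the negated function into [x - J x], and the negative part of [- X] is [X^\+]. *)
  have /cvgNy_compNP/cvgeN :=
    @cvg_integrated_distribution_functionNy _ _ _ _ (- X : {RV P >-> R}).
  rewrite oppeK.
  rewrite (_ : (fun x => _) = (fun x => x%:E - J x)%E); last first.
    apply/funext => x /=; rewrite integrated_distribution_functionN opprK.
    by rewrite EFinN fin_num_oppeD// oppeK.
  rewrite (_ : ((- X : {RV P >-> R}) : T -> R)^\- = (X : T -> R)^\+)//.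
  by apply/funext => w; rewrite /funrpos /funrneg/= opprK.
split.
  split.
  - apply: (subgradient_cvg_slope_ninfty SG fJ0).
    exact/fine_cvg/cvg_cdfNy0.
  - apply: (subgradient_cvg_slope_pinfty SG fJ0).
    exact/fine_cvg/cvg_cdfy1.
split=> x; last exact: integrated_distribution_functionN.
have Fl : F t @[t --> x^'-] --> Fleft x by exact: distribution_function_leftP.
have Fr : F t @[t --> x^'+] --> F x by exact: distribution_function_right_continuous.
split.
(* Finiteness of [J] turns the extended-real subgradient inequality into the real one. *)
- apply/seteqP; split=> u /=; rewrite in_itv/= => H.
    apply/(subgradientP SG Fl Fr) => y.
    by rewrite -lee_fin EFinD !fineK.
  move=> y; rewrite -(fineK (Jfin x)) -(fineK (Jfin y)) -EFinD lee_fin.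
  by move: y; apply/(subgradientP SG Fl Fr).
- exact: (subgradient_left_derivative SG Fl).
- exact: (subgradient_right_derivative SG Fr).
Qed.
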